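(* Suppose $f\colon S\to S$ is any homeomorphism of a connected surface $S$, and let $M_f$ be its mapping torus. Then the inclusion $i\colon S\to M_f$ given by $i(x)=(x,0)$ admits a continuous extension to the end compactifications. Moreover, the induced map on end spaces $i_*\colon\mathrm{Ends}(S)\to\mathrm{Ends}(M_f)$ is a continuous, $f_*$-invariant surjection; that is, it is continuous, surjective, and $i_*\circ f_*=i_*$.
   Context: $\mathrm{Ends}(X)$ denotes the (Freudenthal) space of ends of a manifold $X$, and the end compactification of $X$ is $X\cup\mathrm{Ends}(X)$ with its usual topology. A homeomorphism $f\colon S\to S$ induces a homeomorphism $f_*\colon\mathrm{Ends}(S)\to\mathrm{Ends}(S)$. The mapping torus of $f$ is $M_f=S\times[0,1]/\big((x,1)\sim(f(x),0)\big)$. *)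

(* Defs.v *)
From HB Require Import structures.
From Stdlib Require Import Relation_Operators.
From mathcomp Require Import all_boot all_order all_algebra generic_quotient.
From mathcomp Require Import all_classical all_reals topology normedtype.

Set Implicit Arguments.
Unset Strict Implicit.
Unset Printing Implicit Defensive.

Import Order.TTheory GRing.Theory Num.Theory numFieldNormedType.Exports.

Local Open Scope classical_set_scope.
Local Open Scope ring_scope.

Record homeomorphism (X Y : topologicalType) := Homeomorphism {
  homeo_fun :> X -> Y;
  homeo_inv : Y -> X;
  homeo_funK : cancel homeo_fun homeo_inv;
  homeo_invK : cancel homeo_inv homeo_fun;
  homeo_fun_continuous : continuous homeo_fun;
  homeo_inv_continuous : continuous homeo_inv
}.

Definition half_plane {R : realType} : set (R * R) := [set p | 0 <= p.2].

(* Surfaces are second countable, Hausdorff, and may have boundary.  An open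
   subset of the plane embeds as an open subset of the open half-plane, so a
   surface without boundary is in particular a surface in this sense.  [U] and
   [V `&` half_plane] are coerced to types carrying the subspace topology. *)
Definition surface (R : realType) (S : topologicalType) : Prop :=
  [/\ hausdorff_space S,
      @second_countable S &
      forall x : S, exists (U : set S) (V : set (R * R)),
        [/\ open U, U x, open V &
            inhabited (homeomorphism U (V `&` half_plane))]].

Section Ends.
Variable X : topologicalType.

(* An end chooses coherently, for every compact [K], a connected component of
   the complement of [K]: it is a point of the inverse limit of the sets of
   components of the [~` K].  Coherence forces every [e K] to have
   non-compact closure.  The last clause fixes the irrelevant values of [e],
   so that equality of ends is pointwise equality on compact sets. *)
Definition is_end (e : set X -> set X) : Prop :=
  [/\ forall K, compact K ->
        exists2 x, (~` K) x & e K = connected_component (~` K) x,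
      forall K L, compact K -> compact L -> K `<=` L -> e L `<=` e K &
      forall K, ~ compact K -> e K = set0].

Record Ends := MkEnd { end_fun :> set X -> set X; endP : is_end end_fun }.

HB.instance Definition _ := gen_eqMixin Ends.
HB.instance Definition _ := gen_choiceMixin Ends.

Lemma end_component (e : Ends) K x : compact K -> e K x ->
  e K = connected_component (~` K) x.
Proof.
case: (endP e) => + _ _ => /[apply] -[y _ ->] xy.
have ySx := component_connected (A := ~` K) (x := y).
apply/seteqP; split.
  by apply: connected_component_max => //; exact: connected_component_sub.
have Kx := connected_component_sub xy.
apply: connected_component_max; last exact: component_connected.
  have yx := connected_component_max xy (@connected_component_sub _ (~` K) y) ySx.
  apply: yx; case: xy => C [Cy CK _] _.
  by apply: connected_component_refl; exact: CK.
exact: connected_component_sub.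
Qed.

Lemma end_neq0 (e : Ends) K : compact K -> e K !=set0.
Proof.
case: (endP e) => + _ _ => /[apply] -[y Ky ->].
by exists y; exact: connected_component_refl.
Qed.

Lemma end_le (e : Ends) K L : compact K -> compact L -> K `<=` L ->
  e L `<=` e K.
Proof. by case: (endP e) => _ + _; exact. Qed.

Lemma end_eq_le (e e' : Ends) K L : compact K -> compact L -> K `<=` L ->
  e' L = e L -> e' K = e K.
Proof.
move=> cK cL KL eL; have [x ex] := end_neq0 e cL.
have e'x : e' L x by rewrite eL.
rewrite (end_component cK (end_le cK cL KL ex)).
by rewrite (end_component cK (end_le cK cL KL e'x)).
Qed.

(* the inverse limit topology: the sets [set e' | e' K = e K], for [K]
   compact, form a basis of neighbourhoods of [e] *)
Definition ends_open (U : set Ends) : Prop :=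
  forall e, U e ->
    exists2 K, compact K & [set e' : Ends | e' K = e K] `<=` U.

Lemma ends_openT : ends_open setT.
Proof. by move=> e _; exists set0 => //; exact: compact0. Qed.

Lemma ends_openI : setI_closed ends_open.
Proof.
move=> U V oU oV e [/oU[K cK KU] /oV[L cL LV]].
have cKL := compactU cK cL; exists (K `|` L) => // e' e'E.
split; first by apply: KU; apply: end_eq_le e'E => //; exact: subsetUl.
by apply: LV; apply: end_eq_le e'E => //; exact: subsetUr.
Qed.

Lemma ends_open_bigU (I : Type) (U : I -> set Ends) :
  (forall i, ends_open (U i)) -> ends_open (\bigcup_i U i).
Proof.
move=> oU e [i _ /(oU i)[K cK KU]]; exists K => // e' /KU ?.
by exists i.
Qed.

HB.instance Definition _ :=
  @isOpenTopological.Build Ends ends_open ends_openT ends_openI ends_open_bigU.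

Definition end_compactification : Type := (X + Ends)%type.

HB.instance Definition _ := Choice.on end_compactification.

(* [X] is open with its own topology, and the sets
   [e K `|` {e' | e' K = e K}], for [K] compact, form a basis of
   neighbourhoods of the end [e] (components of [~` K] are open when [X] is
   Hausdorff and locally connected). *)
Definition ec_open (W : set end_compactification) : Prop :=
  open [set x : X | W (inl x)] /\
  forall e : Ends, W (inr e) ->
    exists2 K, compact K &
      (forall x, e K x -> W (inl x)) /\
      (forall e' : Ends, e' K = e K -> W (inr e')).

Lemma ec_openT : ec_open setT.
Proof.
split; first exact: openT.
by move=> e _; exists set0 => //; exact: compact0.
Qed.

Lemma ec_openI : setI_closed ec_open.
Proof.
move=> U V [oU eU] [oV eV]; split; first exact: openI.
move=> e [/eU[K cK [KX KE]] /eV[L cL [LX LE]]].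
have cKL := compactU cK cL; exists (K `|` L) => //; split.
- move=> x ex; split.
    by apply: KX; apply: end_le ex => //; exact: subsetUl.
  by apply: LX; apply: end_le ex => //; exact: subsetUr.
- move=> e' e'E; split.
    by apply: KE; apply: end_eq_le e'E => //; exact: subsetUl.
  by apply: LE; apply: end_eq_le e'E => //; exact: subsetUr.
Qed.

Lemma ec_open_bigU (I : Type) (U : I -> set end_compactification) :
  (forall i, ec_open (U i)) -> ec_open (\bigcup_i U i).
Proof.
move=> oU; split.
  rewrite (_ : [set x | _] = \bigcup_i [set x | U i (inl x)]) //.
  by apply: bigcup_open => i _; case: (oU i).
move=> e [i _]; have [_ eU] := oU i.
move=> /eU[K cK [KX KE]]; exists K => //.
by split=> [x /KX|e' /KE] ?; exists i.
Qed.

HB.instance Definition _ := @isOpenTopological.Build end_compactification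
  ec_open ec_openT ec_openI ec_open_bigU.

End Ends.

Section EndsMap.
Variables (X Y : topologicalType) (f : homeomorphism X Y).

Lemma homeo_preimageE (K : set Y) : f @^-1` K = homeo_inv f @` K.
Proof.
apply/seteqP; split => [x Kx|_ [y Ky <-]] /=.
  by exists (f x) => //; rewrite homeo_funK.
by rewrite homeo_invK.
Qed.

Lemma homeo_compact (K : set Y) : compact (f @^-1` K) <-> compact K.
Proof.
split => cK; last first.
  rewrite homeo_preimageE; apply: continuous_compact => //.
  by apply: continuous_subspaceT => x; exact: homeo_inv_continuous.
have -> : K = f @` (f @^-1` K).
  apply/seteqP; split => [y Ky|_ [x Kx <-]] //.
  by exists (homeo_inv f y); rewrite /= homeo_invK.
apply: continuous_compact => //.
by apply: continuous_subspaceT => x; exact: homeo_fun_continuous.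
Qed.

Lemma homeo_component (A : set Y) (x : X) :
  f @` connected_component (f @^-1` A) x = connected_component A (f x).
Proof.
apply/seteqP; split=> [_ [y [C [Cx CA cC] Cy] <-]|y [C [Cx CA cC] Cy]].
  exists (f @` C); last by exists y.
  split; [by exists x | by move=> _ [z /CA ? <-] |].
  apply: connected_continuous_connected => //.
  by apply: continuous_subspaceT => z; exact: homeo_fun_continuous.
exists (homeo_inv f y); last exact: homeo_invK.
exists (homeo_inv f @` C); last by exists y.
split; first by exists (f x) => //; rewrite homeo_funK.
  by move=> _ [z /CA ? <-]; rewrite /= homeo_invK.
apply: connected_continuous_connected => //.
by apply: continuous_subspaceT => z; exact: homeo_inv_continuous.
Qed.

Definition ends_map_fun (e : Ends X) : set Y -> set Y :=
  fun K => f @` e (f @^-1` K).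

Lemma ends_map_subproof (e : Ends X) : is_end (ends_map_fun e).
Proof.
have [e1 e2 e3] := endP e; split.
- move=> K /homeo_compact /e1[x Kx eK]; exists (f x) => //.
  by rewrite /ends_map_fun eK preimage_setC homeo_component.
- move=> K L /homeo_compact cK /homeo_compact cL KL.
  by apply: image_subset; apply: e2 => // x /KL.
- move=> K cK; rewrite /ends_map_fun e3 ?image_set0 // => /homeo_compact.
  exact: cK.
Qed.

Definition ends_map (e : Ends X) : Ends Y := MkEnd (ends_map_subproof e).

End EndsMap.

Section MappingTorus.
Local Open Scope quotient_scope.
Variables (R : realType) (S : topologicalType) (f : S -> S).

Definition unit_interval : topologicalType := set_type (`[0, 1]%classic : set R).

Lemma mem_itv01_0 : (0 : R) \in (`[0, 1]%classic : set R).
Proof. by rewrite inE /= in_itv /= lexx ler01. Qed.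

Definition itv01_0 : unit_interval := exist _ (0 : R) mem_itv01_0.

(* (x, 1) is glued to (f x, 0) *)
Definition torus_glue (p q : S * unit_interval) : Prop :=
  [/\ \val p.2 = 1 :> R, \val q.2 = 0 :> R & q.1 = f p.1].

Definition torus_rel_fun (p q : S * unit_interval) : bool :=
  `[< clos_refl_sym_trans _ torus_glue p q >].

Lemma torus_rel_refl : reflexive torus_rel_fun.
Proof. by move=> p; apply/asboolP; exact: rst_refl. Qed.

Lemma torus_rel_sym : symmetric torus_rel_fun.
Proof. by move=> p q; apply: asbool_equiv_eq; split; exact: rst_sym. Qed.

Lemma torus_rel_trans : transitive torus_rel_fun.
Proof.
by move=> q p r /asboolP pq /asboolP qr; apply/asboolP; exact: rst_trans qr.
Qed.

Definition torus_rel :=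
  EquivRel torus_rel_fun torus_rel_refl torus_rel_sym torus_rel_trans.

Definition mapping_torus : topologicalType :=
  quotient_topology {eq_quot torus_rel}.

Definition torus_incl (x : S) : mapping_torus :=
  \pi_{eq_quot torus_rel} (x, itv01_0).

End MappingTorus.

(* Main.v *)
Require Import Defs.
From Stdlib Require Import Relation_Operators.
From mathcomp Require Import all_boot all_order all_algebra generic_quotient.
From mathcomp Require Import all_classical all_reals topology normedtype.
From mathcomp Require Import lra.

(** The mapping torus is covered by the intervals [{x} x [0,1]], and every
    compact [K] in it is caught by a compact [L] of [S]: the interval over any
    [x] outside [L] avoids [K].  Hence the inclusion maps the component [e L] of
    an end [e] into a single component of the complement of [K], which does not
    depend on [L]; this defines [i_* e].  Moving along the interval over [x]
    joins [i x] to [i (f x)], whence [i_* (f_* e) = i_* e].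

    For surjectivity, let [eps] be an end of the mapping torus.  The sets
    [{x | x notin L /\ eps K (i x)}], for [L] catching [K], form a proper filter
    base; extend it to an ultrafilter on [S].  For [L] compact, pick a compact
    [L'] with [L] in its interior: every point outside [L'] lies in a component
    of the complement of [L] that meets the frontier of [L'], and since
    components are open only finitely many of them do.  So exactly one component
    of the complement of [L] belongs to the ultrafilter, and these components
    form an end [e] with [i_* e = eps]. *)

Set Implicit Arguments.
Unset Strict Implicit.
Unset Printing Implicit Defensive.

Import Order.TTheory GRing.Theory Num.Theory numFieldNormedType.Exports.

Local Open Scope classical_set_scope.
Local Open Scope ring_scope.

(** * Compact and connected sets *)

(** Plays the part of finite subcovers in the compactness arguments below. *)
Lemma compact_ind (X : topologicalType) (P : set X -> Prop) (K : set X) :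
  P set0 -> (forall A B, P A -> P B -> P (A `|` B)) ->
  (forall A B, A `<=` B -> P B -> P A) ->
  (forall x, K x -> exists2 A, nbhs x A & P A) -> compact K -> P K.
Proof.
move=> P0 PU PS PK cK; apply: contrapT => nPK.
(* a cluster point of this filter has no neighborhood satisfying [P] *)
pose F : set_system X := [set B | P (K `\` B)].
have FF : ProperFilter F.
  split; first by rewrite /F /= setD0.
  split; first by rewrite /F /= setDT.
    by move=> A B FA FB; rewrite /F /= setDIr; exact: PU.
  by move=> A B AB; apply: PS => x [Kx nBx]; split=> // /AB.
have FK : F K by rewrite /F /= setDv.
have [x [Kx clx]] := cK F FF FK.
have [A xA PA] := PK x Kx.
have FA : F (K `\` A).
  by apply: PS PA => y [Ky /not_andP[//|/contrapT]].
by have [y [[]]] := clx _ _ FA xA.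
Qed.

(** [g] inverts [\val] over [B] continuously, so compactness and connectedness pass from [B] to its
    copy in the subspace type. *)
Lemma set_type_section (X : topologicalType) (A B : set X) :
  B `<=` A -> B !=set0 -> exists2 g : X -> A, {within B, continuous g} &
    g @` B = [set x | B (\val x)].
Proof.
move=> BA [b Bb]; have Ab : b \in A by rewrite inE; exact: BA.
have gK (a : A) : 'valL_(exist _ b Ab) id (\val a) = a :> A.
  exact: (congr1 (@^~ a) (valLK (exist _ b Ab) (@id A))).
(* Extends the identity of [A] to [X] by the value [b] outside [A]. *)
exists ('valL_(exist _ b Ab) (@id A)).
  apply: (continuous_subspaceW BA).
  by apply/subspace_valL_continuousP' => a; exact: cvg_id.
apply/seteqP; split=> [_ [x Bx <-]|x Bx]; last by exists (\val x).
have Ax : x \in A by rewrite inE; exact: BA.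
by rewrite /mkset (gK (exist _ x Ax)).
Qed.

Lemma compact_set_type (X : topologicalType) (A B : set X) :
  B `<=` A -> compact B -> compact [set x : A | B (\val x)].
Proof.
move=> BA cB; have [->|/set0P B0] := eqVneq B set0; first exact: compact0.
have [g cg <-] := set_type_section BA B0; exact: continuous_compact.
Qed.

Lemma connected_set_type (X : topologicalType) (A B : set X) :
  B `<=` A -> connected B -> connected [set x : A | B (\val x)].
Proof.
move=> BA cB; have [->|/set0P B0] := eqVneq B set0; first exact: connected0.
have [g cg <-] := set_type_section BA B0.
exact: connected_continuous_connected.
Qed.

Lemma setX_connected (X Y : topologicalType) (A : set X) (B : set Y) :
  connected A -> connected B -> connected (A `*` B).
Proof.
move=> cA cB; have [->|/set0P[b Bb]] := eqVneq B set0.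
  by rewrite setX0; exact: connected0.
have [->|/set0P[a Aa]] := eqVneq A set0.
  by rewrite set0X; exact: connected0.
(* Crosses: the fibre over [x] together with the slice at height [b]; all of them contain
   [(a, b)]. *)
have -> : A `*` B =
    \bigcup_(x in A) ((fun y => (x, y)) @` B `|` (fun x => (x, b)) @` A).
  apply/seteqP; split=> [[x y] [/= Ax By]|].
    by exists x => //; left; exists y.
  by move=> _ [x Ax [[y By <-]|[x' Ax' <-]]].
apply: bigcup_connected.
  by exists (a, b) => x Ax; right; exists a.
move=> x Ax; apply: connectedU.
- by exists (x, b); split; [exists b | exists x].
- apply: connected_continuous_connected => //; apply: continuous_subspaceT.
  by move=> y; apply: cvg_pair => //=; exact: cvg_cst.
- apply: connected_continuous_connected => //; apply: continuous_subspaceT.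
  by move=> y; apply: cvg_pair => //=; exact: cvg_cst.
Qed.

(** Truncating the lower side at 0 keeps the box a product of two segments, hence compact and
    connected, even at a boundary point. *)
Definition half_box (R : realType) (p : R * R) (r : R) : set (R * R) :=
  `[p.1 - r, p.1 + r]%classic `*` `[Num.max 0 (p.2 - r), p.2 + r]%classic.

Lemma half_box_nbhs (R : realType) (p : R * R) (O : set (R * R)) :
  nbhs p O -> exists r : R, [/\ 0 < r, half_box p r `<=` O `&` half_plane &
    ball p r `&` half_plane `<=` half_box p r].
Proof.
move=> /nbhs_ballP[e /= e0 eO].
(* Half the radius puts the closed box inside the open ball. *)
exists (e / 2); split; first by rewrite divr_gt0.
- move=> [x y] [] /=; rewrite !in_itv /= => /andP[x1 x2] /andP[].
  rewrite ge_max => /andP[y0 y1] y2; split => //; apply: eO.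
  by split; rewrite /ball /= ltr_norml; apply/andP; split; lra.
- move=> [x y] [[]]; rewrite /ball /= !ltr_norml => /andP[x1 x2] /andP[y1 y2].
  rewrite /half_plane /= => y0; split => /=; rewrite in_itv /=.
    by apply/andP; split; lra.
  by rewrite ge_max y0 /=; apply/andP; split; lra.
Qed.

Definition locally_compact_connected (X : topologicalType) : Prop :=
  forall (x : X) (O : set X), nbhs x O ->
    exists A, [/\ nbhs x A, A `<=` O, compact A & connected A].

(** Half boxes in a chart, carried back to [S], are the required neighborhoods. *)
Lemma surface_lcc (R : realType) (S : topologicalType) :
  surface R S -> locally_compact_connected S.
Proof.
move=> [_ _ charts] x O xO; have [U [V [oU Ux oV [h]]]] := charts x.
have UxE : x \in U by rewrite inE.
pose u : U := exist _ x UxE.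
pose p : R * R := \val (h u).
have [Vp hp] : (V `&` half_plane) p by exact: set_valP (h u).
have cj : continuous (\val \o homeo_inv h).
  move=> z; apply: continuous_comp; first exact: homeo_inv_continuous.
  exact: initial_continuous.
have ck : continuous (\val \o h).
  move=> z; apply: continuous_comp; first exact: homeo_fun_continuous.
  exact: initial_continuous.
have hu : (\val \o homeo_inv h) (h u) = x by rewrite /= homeo_funK.
have : nbhs (h u) ((\val \o homeo_inv h) @^-1` O).
  by apply: cj; rewrite hu.
move=> [_ [/= [W oW <-]] Wp WO].
have [r [r0 bO bb]] : exists r : R, [/\ 0 < r,
    half_box p r `<=` (V `&` W) `&` half_plane &
    ball p r `&` half_plane `<=` half_box p r].
  by apply: half_box_nbhs; apply: open_nbhs_nbhs; split; [exact: openI|split].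
have bVH : half_box p r `<=` V `&` half_plane by move=> z /bO[[]].
exists ((\val \o homeo_inv h) @` [set z | half_box p r (\val z)]); split.
- have : nbhs u ((\val \o h) @^-1` ball p r).
    by apply: ck; exact: nbhsx_ballx.
  move=> [_ [/= [N oN <-]] Nx NO].
  have : nbhs x (N `&` U) by apply: open_nbhs_nbhs; split; [exact: openI|].
  apply: filterS => y [Ny Uy].
  have UyE : y \in U by rewrite inE.
  exists (h (exist _ y UyE)); last by rewrite /= homeo_funK.
  apply: bb; split; first exact: (NO (exist _ y UyE)).
  by case: (set_valP (h (exist _ y UyE))).
- by move=> _ [z bz <-]; apply: WO => /=; case: (bO _ bz) => [[]].
- apply: (@continuous_compact (set_type (V `&` half_plane)) S).
    exact: continuous_subspaceT.
  apply: compact_set_type => //.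
  by apply: compact_setX; exact: segment_compact.
- apply: (@connected_continuous_connected (set_type (V `&` half_plane)) S);
    last exact: continuous_subspaceT.
  apply: connected_set_type => //.
  by apply: setX_connected; exact: segment_connected.
Qed.

(** * Components and ends *)

Section Components.
Variable X : topologicalType.
Hypothesis lccX : locally_compact_connected X.

Lemma component_open (O : set X) (x : X) :
  open O -> open (connected_component O x).
Proof.
move=> oO; rewrite openE => y Cy.
have Oy := connected_component_sub Cy.
have [A [yA AO _ cA]] := lccX (open_nbhs_nbhs (conj oO Oy)).
rewrite /interior (same_connected_component Cy); apply: filterS (yA).
by apply: connected_component_max => //; exact: nbhs_singleton yA.
Qed.

Lemma compact_sub_interior (L : set X) : compact L ->
  exists2 L', compact L' & L `<=` L'^°.
Proof.
move=> cL; pattern L; apply: compact_ind (cL).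
- by exists set0 => //; exact: compact0.
- move=> A B [A' cA' AA'] [B' cB' BB']; exists (A' `|` B').
    exact: compactU.
  move=> x [/AA'|/BB']; rewrite /interior; apply: filterS => y; by [left|right].
- by move=> A B AB [B' cB' BB']; exists B' => // x /AB /BB'.
- move=> x _; have [A [xA _ cA _]] := lccX (@filterT _ (nbhs x) _).
  by exists A^°; [exact: nbhs_interior | exists A].
Qed.

Hypotheses (hX : hausdorff_space X) (connX : connected [set: X]).

Lemma component_meets_frontier (L L' : set X) (x : X) :
  compact L -> compact L' -> L `<=` L'^° -> L' !=set0 -> ~ L' x ->
  exists2 z, (L' `\` L'^°) z & connected_component (~` L) x z.
Proof.
move=> cL cL' LL' [w L'w] nL'x; apply: contrapT => noz.
have oLC : open (~` L) by apply: closed_openC; exact: compact_closed.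
have oL'C : open (~` L') by apply: closed_openC; exact: compact_closed.
(* Otherwise [D] is clopen. *)
pose D := connected_component (~` L) x `&` ~` L'.
have nLx : (~` L) x by move=> /LL'/interior_subset.
suff : D = setT by move=> DT; have [] : D w by rewrite DT.
apply: connX.
- by exists x; split => //; exact: connected_component_refl.
- by exists D; rewrite ?setTI //; apply: openI => //; exact: component_open.
- exists D; rewrite ?setTI // => y clDy.
  have nLy : (~` L'^°) y.
    move=> L'y; have [z [[_ nz] /interior_subset]] : (D `&` L'^°) !=set0.
      by apply: clDy; apply: open_nbhs_nbhs; split => //; exact: open_interior.
    exact: nz.
  have LCy : (~` L) y by move=> /LL'.
  (* The open component of [y] meets [D], so [y] lies in the component of [x]; if in [L'], it would
     be a frontier point. *)
  have [z [[xz _] yz]] : (D `&` connected_component (~` L) y) !=set0.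
    apply: clDy; apply: open_nbhs_nbhs; split; first exact: component_open.
    exact: connected_component_refl.
  have xy : connected_component (~` L) x y.
    by apply: connected_component_trans xz _; exact: connected_component_sym.
  by split => // L'y; apply: noz; exists y.
Qed.

Lemma ultra_component (U : set_system X) (L : set X) :
  UltraFilter U -> (forall K, compact K -> U (~` K)) -> compact L ->
  exists2 x, (~` L) x & U (connected_component (~` L) x).
Proof.
move=> UU UC cL; have [x0 _] := filter_ex (@filterT _ U _).
(* Adding the point [x0] makes [L'] nonempty, as [component_meets_frontier] requires. *)
have [L' cL' LL'] := compact_sub_interior (compactU cL (@compact_set1 _ x0)).
apply: contrapT => noC.
(* If no component belongs to [U], then [near A] is not in [U] for small [A],
   hence by compactness for [A] the frontier of [L']. *)
pose near A := [set x | exists2 z, A z & connected_component (~` L) x z].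
suff : ~ U (near (L' `\` L'^°)).
  apply; apply: filterS (UC _ cL') => x L'x.
  apply: component_meets_frontier => //; first by move=> y Ly; apply: LL'; left.
  by exists x0; apply: interior_subset; apply: LL'; right.
have cF : compact (L' `\` L'^°).
  rewrite setDE; apply: compact_closedI => //.
  by apply: open_closedC; exact: open_interior.
pattern (L' `\` L'^°); apply: compact_ind cF.
- by move=> /filter_ex[x []].
- move=> A B nA nB UAB.
  have [//|UnA] := in_ultra_setVsetC (near A) UU.
  apply: nB; apply: filterS (filterI UAB UnA) => x [[z [Az|Bz] xz] nAx].
    by case: nAx; exists z.
  by exists z.
- move=> A B AB nB nA; apply: nB; apply: filterS nA => x [z Az xz].
  by exists z => //; exact: AB.
- move=> z [_ nz].
  have LCz : (~` L) z by move=> Lz; apply: nz; apply: LL'; left.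
  (* With this component as [A], [near A] lies in the same component. *)
  exists (connected_component (~` L) z).
    apply: open_nbhs_nbhs; split; last exact: connected_component_refl.
    by apply: component_open; apply: closed_openC; exact: compact_closed.
  move=> UA; apply: noC; exists z => //; apply: filterS UA => x [y zy xy].
  by apply: connected_component_trans zy _; exact: connected_component_sym.
Qed.

End Components.

Lemma end_sub (X : topologicalType) (e : Ends X) (K : set X) :
  compact K -> e K `<=` ~` K.
Proof.
move=> cK x ex; have := ex; rewrite (end_component cK ex).
exact: connected_component_sub.
Qed.

Lemma end_ext (X : topologicalType) (e e' : Ends X) :
  (forall K, compact K -> e K = e' K) -> e = e'.
Proof.
move=> ee'; suff eE : end_fun e = end_fun e'.
  case: e e' eE {ee'} => [g gE] [g' gE'] /= eE.
  by rewrite eE in gE *; rewrite (Prop_irrelevance gE gE').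
apply/funext => K; have [cK|ncK] := pselect (compact K); first exact: ee'.
by case: (endP e) => _ _ ->//; case: (endP e') => _ _ ->.
Qed.

Lemma ultra_end (X : topologicalType) (U : set_system X) :
  locally_compact_connected X -> hausdorff_space X -> connected [set: X] ->
  UltraFilter U -> (forall K, compact K -> U (~` K)) ->
  exists e : Ends X, forall K, compact K -> U (e K).
Proof.
move=> lcc hX connX UU UC.
have /choice[e eP] : forall K, exists C : set X,
    (compact K -> U C /\
      exists2 x, (~` K) x & C = connected_component (~` K) x) /\
    (~ compact K -> C = set0).
  move=> K.
  have [cK|ncK] := pselect (compact K); last by exists set0.
  have [x Kx UCx] := ultra_component lcc hX connX UU UC cK.
  by exists (connected_component (~` K) x); split=> // _; split=> //; exists x.
have eE : is_end e.
  split; last by move=> K /(proj2 (eP K)).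
    by move=> K /(proj1 (eP K))[].
  move=> K L cK cL KL.
  have [UK [x Kx eK]] := proj1 (eP K) cK.
  have [UL [y Ly eL]] := proj1 (eP L) cL.
  (* Both chosen components belong to [U], so they share a point [z]; seen as components of [z] they
     are nested. *)
  have [z []] := filter_ex (filterI UK UL).
  rewrite eK eL => xz yz; rewrite (same_connected_component xz).
  rewrite (same_connected_component yz).
  apply: connected_component_max.
  - apply: connected_component_refl; exact: connected_component_sub yz.
  - by apply: subset_trans (@connected_component_sub _ _ _) _ => w Lw /KL.
  - exact: component_connected.
by exists (MkEnd eE) => K cK; have [] := proj1 (eP K) cK.
Qed.

(** * The mapping torus *)

Section UnitInterval.
Variable R : realType.

Lemma unit_interval_val :
  [set t : unit_interval R | `[0, 1]%classic (\val t)] = setT.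
Proof. by apply/seteqP; split=> // t _; exact: (set_valP t). Qed.

Lemma unit_interval_compact : compact [set: unit_interval R].
Proof.
rewrite -unit_interval_val; apply: compact_set_type => //.
exact: segment_compact.
Qed.

Lemma unit_interval_connected : connected [set: unit_interval R].
Proof.
rewrite -unit_interval_val; apply: connected_set_type => //.
exact: segment_connected.
Qed.

Lemma mem_itv01_1 : (1 : R) \in (`[0, 1]%classic : set R).
Proof. by rewrite inE /= in_itv /= lexx ler01. Qed.

Definition itv01_1 : unit_interval R := exist _ (1 : R) mem_itv01_1.

End UnitInterval.

Section Torus.
Local Open Scope quotient_scope.
Variables (R : realType) (S : topologicalType) (f : homeomorphism S S).

Local Notation M := (mapping_torus R f).
Local Notation I := (unit_interval R).

Definition torus_proj (p : S * I) : M := \pi_{eq_quot torus_rel R f} p.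

Lemma torus_proj_continuous : continuous torus_proj.
Proof. exact: pi_continuous. Qed.

Lemma torus_open (W : set M) : open (torus_proj @^-1` W) -> open W.
Proof. by []. Qed.

Lemma torus_proj_surj (y : M) : exists x t, y = torus_proj (x, t).
Proof.
exists (repr y).1, (repr y).2; rewrite -surjective_pairing.
by rewrite /torus_proj -[LHS]reprK.
Qed.

Lemma torus_proj_glue (x : S) :
  torus_proj (x, itv01_1 R) = torus_proj (f x, itv01_0 R).
Proof. by apply/eqmodP; apply/asboolP; exact: rst_step. Qed.

(** By induction on the generated equivalence, without an explicit description of its classes. *)
Lemma torus_proj_saturated (P : S * I -> Prop) (p q : S * I) :
  (forall p q, torus_glue f p q -> P p <-> P q) ->
  torus_proj p = torus_proj q -> P p <-> P q.
Proof.
move=> Pglue /eqmodP /asboolP; elim=> //.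
- by move=> {}p {}q _ ->.
- by move=> {}p {}q r _ -> _ ->.
Qed.

Lemma torus_incl_continuous : continuous (torus_incl R f).
Proof.
move=> x.
apply: (@continuous_comp S (S * I)%type M (fun x => (x, itv01_0 R)) torus_proj).
  exact: (cvg_pair (@cvg_id _ (nbhs x)) (cvg_cst _)).
exact: torus_proj_continuous.
Qed.

(** * Compact sets of the mapping torus and their traces on the surface *)

Definition catches (K : set M) (L : set S) : Prop :=
  compact L /\ forall x t, K (torus_proj (x, t)) -> L x.

Lemma val_continuous : continuous (\val : I -> R).
Proof. exact: initial_continuous. Qed.

Lemma catchesS (K K' : set M) (L : set S) :
  K `<=` K' -> catches K' L -> catches K L.
Proof. by move=> KK' [cL KL]; split=> // x t /KK' /KL. Qed.

Lemma catches_exists (K : set M) : locally_compact_connected S ->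
  compact K -> exists L, catches K L.
Proof.
move=> lcc cK; pattern K; apply: compact_ind cK.
- by exists set0; split=> //; exact: compact0.
- move=> A B [LA [cA AL]] [LB [cB BL]]; exists (LA `|` LB); split.
    exact: compactU.
  by move=> x t [/AL|/BL]; [left|right].
- by move=> A B AB [L BL]; exists L; exact: catchesS AB BL.
move=> y _; have [x [t ->]] := torus_proj_surj y.
(* Below level 1 a neighborhood [A] of [x] suffices; the point at level 1 is also [(f x, 0)], which
   calls for [B]. *)
have [A [xA _ cA _]] := lcc x setT filterT.
have [B [xB _ cB _]] := lcc (f x) setT filterT.
pose U := A^° `|` B^°.
have oU : open U by apply: openU; exact: open_interior.
(* [G] is saturated: at both [(z, 1)] and [(f z, 0)] it means [U (f z)]. *)
pose G := [set p : S * I | (U p.1 /\ \val p.2 < 1 :> R) \/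
                           (U (f p.1) /\ 0 < \val p.2 :> R)].
have Gglue p q : torus_proj p = torus_proj q -> G p <-> G q.
  apply: torus_proj_saturated => {}p {}q [p1 q0 qf]; rewrite /G /= p1 q0 qf.
  by rewrite !ltxx ltr01; split=> [[[]|[]]|[[]|[]]] //; [left|right].
have oG : open G.
  have c2 : continuous (fun p : S * I => \val p.2 : R).
    by move=> p; apply: continuous_comp; [exact: cvg_snd|exact: val_continuous].
  have c1 : continuous (fun p : S * I => f p.1).
    move=> p; apply: continuous_comp; first exact: cvg_fst.
    exact: homeo_fun_continuous.
  apply: openU; apply: openI.
  - by apply: (open_comp (f := fst)) oU => p _; exact: cvg_fst.
  - by apply: open_comp (@open_lt R 1) => p _; exact: c2.
  - by apply: open_comp oU => p _; exact: c1.
  - by apply: open_comp (@open_gt R 0) => p _; exact: c2.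
exists (torus_proj @` G).
  apply: open_nbhs_nbhs; split.
    apply: torus_open; rewrite (_ : _ @^-1` _ = G) //.
    apply/seteqP; split=> [p [q Gq /Gglue]|p Gp]; first by move=> <-.
    by exists p.
  exists (x, t) => //.
  have [t1|t1] := ltP (\val t) 1; [left|right]; split=> //=.
  - by left.
  - by right.
  - exact: lt_le_trans t1.
(* A point [(z, s)] of [G] has [z] or [f z] in [U]. *)
exists ((A `|` B) `|` f @^-1` (A `|` B)); split.
  by apply: compactU; [|apply/homeo_compact]; exact: compactU.
move=> z s [q Gq /Gglue[+ _]] => /(_ Gq)[[]|[]] [] /interior_subset;
  do ?[by left; left|by left; right|by right; left|by right; right].
Qed.

(** The image of the interval over [x] is a connected set avoiding [K]. *)
Lemma torus_track (K : set M) (x : S) (t : I) :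
  (forall t, ~ K (torus_proj (x, t))) ->
  connected_component (~` K) (torus_incl R f x) (torus_proj (x, t)).
Proof.
move=> Kx; exists ((fun t => torus_proj (x, t)) @` setT); last by exists t.
split; [by exists (itv01_0 R) | by move=> _ [s _ <-]; exact: Kx |].
apply: connected_continuous_connected; first exact: unit_interval_connected.
apply: continuous_subspaceT => s.
apply: (@continuous_comp I (S * I)%type M (fun t => (x, t)) torus_proj).
  exact: (cvg_pair (cvg_cst x) (@cvg_id _ (nbhs s))).
exact: torus_proj_continuous.
Qed.

Lemma torus_incl_end_component (K : set M) (L : set S) (e : Ends S) (x y : S) :
  catches K L -> e L x -> e L y ->
  connected_component (~` K) (torus_incl R f x) (torus_incl R f y).
Proof.
move=> [cL KL] ex ey; exists (torus_incl R f @` e L); last by exists y.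
split; first by exists x.
  move=> _ [z ez <-] /KL Lz; exact: end_sub ez Lz.
apply: connected_continuous_connected.
  by rewrite (end_component cL ex); exact: component_connected.
by apply: continuous_subspaceT; exact: torus_incl_continuous.
Qed.

(** * The induced map on ends and its invariance *)

Hypothesis lccS : locally_compact_connected S.

(** Quantifying over all [L] and [x] avoids a choice; the clause [compact K] yields the empty value
    that [is_end] prescribes for other sets. *)
Definition torus_incl_ends_fun (e : Ends S) (K : set M) : set M :=
  [set y | compact K /\ exists L x, [/\ catches K L, e L x &
    connected_component (~` K) (torus_incl R f x) y]].

(** Two catching sets are compared through a point [z] of the component that [e] selects for their
    union: [z] lies in both [e L] and [e L']. *)
Lemma torus_incl_ends_funE (e : Ends S) (K : set M) (L : set S) (x : S) :
  compact K -> catches K L -> e L x ->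
  torus_incl_ends_fun e K = connected_component (~` K) (torus_incl R f x).
Proof.
move=> cK KL ex; apply/seteqP; split=> [y [_ [L' [x' [KL' ex' x'y]]]]|y xy].
  have cU := compactU KL.1 KL'.1; have [z ez] := end_neq0 e cU.
  have eLz := end_le KL.1 cU (@subsetUl _ _ _) ez.
  have exz := torus_incl_end_component KL ex eLz.
  apply: connected_component_trans x'y; apply: connected_component_trans exz _.
  apply: connected_component_sym; apply: torus_incl_end_component (KL') ex' _.
  exact: end_le KL'.1 cU (@subsetUr _ _ _) _ ez.
by split=> //; exists L, x.
Qed.

Lemma torus_incl_ends_subproof (e : Ends S) : is_end (torus_incl_ends_fun e).
Proof.
split; last by move=> K ncK; rewrite -subset0 => y [].
  move=> K cK; have [L KL] := catches_exists lccS cK.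
  have [x ex] := end_neq0 e KL.1; exists (torus_incl R f x).
    by move=> /KL.2; exact: end_sub KL.1 _ ex.
  exact: torus_incl_ends_funE ex.
move=> K K' cK cK' KK' y [_ [L [x [K'L ex xy]]]].
split=> //; exists L, x; split=> //; first exact: catchesS KK' K'L.
have [C [Cx CK cC] Cy] := xy; exists C => //.
by split=> // z /CK Kz /KK'.
Qed.

Definition torus_incl_ends (e : Ends S) : Ends M :=
  MkEnd (torus_incl_ends_subproof e).

Lemma torus_incl_end_sub (e : Ends S) (K : set M) (L : set S) (x : S) :
  compact K -> catches K L -> e L x -> torus_incl_ends e K (torus_incl R f x).
Proof.
move=> cK KL ex; rewrite /= (torus_incl_ends_funE cK KL ex).
apply: connected_component_refl => /KL.2; exact: end_sub KL.1 _ ex.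
Qed.

Lemma torus_incl_ends_eq (e e' : Ends S) (K : set M) (L : set S) :
  compact K -> catches K L -> e' L = e L ->
  torus_incl_ends e' K = torus_incl_ends e K.
Proof.
move=> cK KL ee'; have [x ex] := end_neq0 e KL.1.
have e'x : e' L x by rewrite ee'.
by rewrite /= (torus_incl_ends_funE cK KL ex) (torus_incl_ends_funE cK KL e'x).
Qed.

Lemma torus_incl_ends_invariant (e : Ends S) :
  torus_incl_ends (ends_map f e) = torus_incl_ends e.
Proof.
apply: end_ext => K cK; have [L KL] := catches_exists lccS cK.
have cfL : compact (f @^-1` L) by apply/homeo_compact; exact: KL.1.
(* Removing both sets places [x] in [e L] and [f x] in [ends_map f e L]. *)
have cU := compactU KL.1 cfL; have [x ex] := end_neq0 e cU.
have exL := end_le KL.1 cU (@subsetUl _ _ _) ex.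
have exfL := end_le cfL cU (@subsetUr _ _ _) ex.
rewrite /= (torus_incl_ends_funE cK KL exL).
have fex : ends_map f e L (f x) by exists x.
rewrite (torus_incl_ends_funE cK KL fex).
suff xfx : connected_component (~` K) (torus_incl R f x) (torus_incl R f (f x)).
  by rewrite (same_connected_component xfx).
(* The image of [f x] is also [(x, 1)], the far end of the interval over [x]. *)
rewrite -[torus_incl R f (f x)]torus_proj_glue.
apply: torus_track => t /KL.2; exact: end_sub KL.1 _ exL.
Qed.

(** * Surjectivity on ends *)

Lemma torus_incl_ends_surj : hausdorff_space S -> connected [set: S] ->
  range torus_incl_ends = setT.
Proof.
move=> hS cS; apply/seteqP; split=> // eps _.
pose D : set (set M * set S) := [set KL | compact KL.1 /\ catches KL.1 KL.2].
pose B (KL : set M * set S) :=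
  [set x | ~ KL.2 x /\ eps KL.1 (torus_incl R f x)].
have FF : ProperFilter (filter_from D B).
  apply: filter_from_proper.
    apply: filter_from_filter.
      by exists (set0, set0); do !split=> //; exact: compact0.
    move=> [K L] [K' L'] [/= cK KL] [/= cK' KL'].
    (* [B] shrinks as both coordinates grow. *)
    exists (K `|` K', L `|` L').
      split; first exact: compactU.
      split; first exact: compactU KL.1 KL'.1.
      by move=> x t [/KL.2|/KL'.2]; [left|right].
    have cU := compactU cK cK'.
    move=> x [/= /not_orP[nL nL'] ex]; split; split=> //=.
      exact: end_le ex.
    exact: end_le ex.
  move=> [K L] [/= cK KL].
  (* [K'] contains the intervals over [L], so [x] is outside [L]. *)
  pose K' := K `|` torus_proj @` (L `*` setT).
  have cK' : compact K'.
    apply: compactU => //; apply: continuous_compact.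
      by apply: continuous_subspaceT; exact: torus_proj_continuous.
    by apply: compact_setX; [exact: KL.1 | exact: unit_interval_compact].
  have [y ey] := end_neq0 eps cK'.
  have [x [t yE]] := torus_proj_surj y; rewrite {}yE in ey.
  have nLx : ~ L x.
    by move=> Lx; apply: (end_sub cK' ey); right; exists (x, t).
  exists x; split=> //=.
  (* Sliding along the interval over [x], which avoids [K], leads from [(x, t)] to [(x, 0)] inside
     [eps K]. *)
  have eKt := end_le cK cK' (@subsetUl _ _ _) ey.
  rewrite (end_component cK eKt); apply: connected_component_sym.
  by apply: torus_track => s /KL.2.
have [U [UU FU]] := ultraFilterLemma FF.
have UC L : compact L -> U (~` L).
  (* Every compact [L] catches the empty set, and [B (set0, L)] misses [L]. *)
  move=> cL; apply: FU; exists (set0, L); last by move=> x [].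
  by split; [exact: compact0 | split].
have [e eU] := ultra_end lccS hS cS UU UC.
exists e => //; apply: end_ext => K cK; have [L KL] := catches_exists lccS cK.
have UB : U (B (K, L)) by apply: FU; exists (K, L).
(* For such an [x], both ends select the component of [torus_incl R f x]. *)
have [x [[_ epsx] ex]] := filter_ex (filterI UB (eU _ KL.1)).
by rewrite (end_component cK epsx) /= (torus_incl_ends_funE cK KL ex).
Qed.

(** * Continuity on ends and on end compactifications *)

Lemma torus_incl_ends_continuous : continuous torus_incl_ends.
Proof.
apply/continuousP => W oW; rewrite -[open _]/(ends_open _) => e We.
have [K cK KW] := oW _ We; have [L KL] := catches_exists lccS cK.
exists L; first exact: KL.1.
by move=> e' /(torus_incl_ends_eq cK KL)/KW.
Qed.

Definition torus_incl_ec (p : end_compactification S) :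
    end_compactification M :=
  match p with
  | inl x => inl (torus_incl R f x)
  | inr e => inr (torus_incl_ends e)
  end.

(** At an end [e], a single [L] catching [K] serves for the points of [e L] and for the nearby
    ends. *)
Lemma torus_incl_ec_continuous : continuous torus_incl_ec.
Proof.
apply/continuousP => W [oW eW]; rewrite -[open _]/(ec_open _); split.
  by move/continuousP: torus_incl_continuous => /(_ _ oW).
move=> e /eW[K cK [KX KE]]; have [L KL] := catches_exists lccS cK.
exists L; first exact: KL.1; split=> [x ex|e' e'E].
  by apply: KX; exact: torus_incl_end_sub ex.
by apply: KE; exact: torus_incl_ends_eq e'E.
Qed.

End Torus.

Unset Implicit Arguments.

Theorem proposition5p1 (R : realType) (S : topologicalType)
    (S_surface : surface R S) (S_connected : connected [set: S])
    (f : homeomorphism S S) :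
  exists F : end_compactification S ->
             end_compactification (mapping_torus R f),
    [/\ continuous F,
        forall x : S, F (inl x) = inl (torus_incl R f x) &
        exists i_star : Ends S -> Ends (mapping_torus R f),
          [/\ forall e : Ends S, F (inr e) = inr (i_star e),
              continuous i_star,
              range i_star = [set: Ends (mapping_torus R f)] &
              forall e : Ends S, i_star (ends_map f e) = i_star e]].
Proof.
have lccS := surface_lcc S_surface.
have [hS _ _] := S_surface.
exists (torus_incl_ec R f lccS); split=> //.
  exact: torus_incl_ec_continuous.
exists (torus_incl_ends R f lccS); split=> //.
- exact: torus_incl_ends_continuous.
- exact: torus_incl_ends_surj.
- exact: torus_incl_ends_invariant.
Qed.
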